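(* Let $K$ be a compact, fragmentable, linearly ordered space, and assume that $K$ contains no order-isomorphic copy of $\kappa$, where $\kappa$ is a regular, uncountable cardinal. Then the topological weight of $K$ is strictly less than $\kappa$. In particular, if $K$ contains no copy of $\omega_1$ then $K$ is metrisable.
   Context: All topological spaces are Hausdorff. A linearly ordered space is a linearly ordered set equipped with its order topology. $\omega_1$ denotes the first uncountable cardinal. The topological weight of a space is the least cardinality of a basis for its topology. A compact space $K$ is fragmentable if there exists a metric $d : K \times K \to [0,\infty)$ (not assumed to be related to the topology of $K$) such that, given any non-empty set $M \subseteq K$ and $\varepsilon > 0$, there exists an open set $U \subseteq K$ with $M \cap U \neq \varnothing$ and $d$-diameter of $M \cap U$ less than $\varepsilon$.
   Formalization: ''Copy of κ'' (and of ω₁) is taken up to reversing the order: K is assumed to contain neither an increasing nor a decreasing copy. Read literally the claim fails for ω₁+1 with reversed order, which is compact and scattered, has no increasing copy of ω₁, and has weight ℵ₁. *)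

(* Defs.v *)
From HB Require Import structures.
From mathcomp Require Import all_boot all_order all_algebra.
From mathcomp Require Import all_classical all_reals all_analysis.
From mathcomp Require wochoice.

Set Implicit Arguments.
Unset Strict Implicit.
Unset Printing Implicit Defensive.

Import Order.TTheory GRing.Theory Num.Theory.

Local Open Scope classical_set_scope.
Local Open Scope ring_scope.
Local Open Scope card_scope.

Record is_metric (R : realType) (T : Type) (d : T -> T -> R) : Prop := IsMetric {
  is_metric_ge0 : forall x y, 0 <= d x y ;
  is_metric_eq0 : forall x y, d x y = 0 <-> x = y ;
  is_metric_sym : forall x y, d x y = d y x ;
  is_metric_triangle : forall x y z, d x z <= d x y + d y z
}.

(* Extended-real valued, since a fragmenting metric need not be bounded. *)
Definition diameter (R : realType) (T : Type) (d : T -> T -> R) (A : set T) :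
    \bar R :=
  ereal_sup [set (d x y)%:E | x in A & y in A].

Definition fragmentable (R : realType) (T : topologicalType) : Prop :=
  exists2 d : T -> T -> R, is_metric d &
    forall (M : set T) (e : R), M !=set0 -> 0 < e ->
      exists U : set T,
        [/\ open U, M `&` U !=set0 & (diameter d (M `&` U) < e%:E)%E].

Definition metrizable (R : realType) (T : topologicalType) : Prop :=
  exists2 d : T -> T -> R, is_metric d &
    forall x : T,
      nbhs x = filter_from [set e : R | 0 < e] (fun e => [set y | d x y < e]).

Definition card_lt (T U : Type) (A : set T) (B : set U) : Prop :=
  A #<= B /\ A #!= B.

Definition weight_basis (T : topologicalType) (B : set (set T)) : Prop :=
  basis B /\ forall C : set (set T), basis C -> B #<= C.

Definition weight_lt (T : topologicalType) (U : Type) (A : set U) : Prop :=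
  exists2 B : set (set T), weight_basis B & card_lt B A.

(* There is no type of ordinals: a cardinal is represented by a linearly
   ordered type W of that order type, which is well ordered and has every
   proper initial segment of strictly smaller cardinality (an initial
   ordinal). *)
Definition initial_ordinal (dW : Order.disp_t) (W : orderType dW) : Prop :=
  wochoice.well_order (<=%O : rel W) /\
  forall w : W, card_lt [set v : W | (v < w)%O] [set: W].

Definition cofinal (dW : Order.disp_t) (W : orderType dW) (A : set W) : Prop :=
  forall w : W, exists2 a, A a & (w <= a)%O.

Definition regular_uncountable_cardinal (dW : Order.disp_t)
    (W : orderType dW) : Prop :=
  [/\ initial_ordinal W,
      ~ countable [set: W] &
      forall A : set W, cofinal A -> A #= [set: W]].

Definition is_omega1 (dW : Order.disp_t) (W : orderType dW) : Prop :=
  [/\ wochoice.well_order (<=%O : rel W),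
      ~ countable [set: W] &
      forall w : W, countable [set v : W | (v < w)%O]].

(* A copy of W may run upwards or downwards in K.  Downward copies have to
   count: the reverse of the ordinal omega_1 + 1 is a compact, scattered (hence
   fragmentable) linearly ordered space of weight aleph_1 in which every
   strictly increasing sequence is finite. *)
Definition contains_copy (dW : Order.disp_t) (W : orderType dW)
    (dK : Order.disp_t) (K : orderType dK) : Prop :=
  (exists f : W -> K, {mono f : x y / (x <= y)%O}) \/
  (exists f : W -> K, {mono f : x y /~ (x <= y)%O}).

(* Main.v *)
Require Import Defs.
From HB Require Import structures.
From mathcomp Require Import all_boot all_order all_algebra.
From mathcomp Require Import all_classical all_reals all_analysis.
From mathcomp Require Import lra.
From mathcomp Require wochoice.

Set Implicit Arguments.
Unset Strict Implicit.
Unset Printing Implicit Defensive.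

Import Order.TTheory GRing.Theory Num.Theory.
Import numFieldNormedType.Exports.

Local Open Scope classical_set_scope.
Local Open Scope card_scope.

(** Call a set small if it has cardinality less than the regular cardinal
    [kappa].  It is enough to find a small set [D] of points of [K] that
    separates the order, in the sense of [order_separating]: the open intervals
    with endpoints in [D] are then a basis, and when [D] is countable, Urysohn
    functions for pairs of points of [D] give a metric.

    Such a [D] is found by a closing-off argument ([exists_separating_set]).
    As [K] has no increasing or decreasing copy of [kappa], every open ray has
    a small cofinal (coinitial) subset ([fewer_dominating]).  Fragmentability
    supplies, for each [n], a transfinite increasing tower of open sets
    exhausting [K] whose successive differences have diameter less than
    [1 / (n + 1)], and each compact interval is first swallowed at a definite
    successor step of the tower ([tower_linear], [fragmentation_cells]).
    Regularity allows a small set [D] to be closed both under the choice of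
    these cofinal sets and under the extreme points of what the tower leaves of
    an interval with endpoints in [D] just before swallowing it
    ([fewer_closure]).

    If [D] fails to separate the order, then its closure has a hole between two
    points [x'] and [y'] outside [D], approached by [D] from the left and from
    the right.  The hole is swallowed at the same step as a slightly larger
    interval with endpoints in [D]; as the extreme points left over by the
    tower belong to [D], they cannot fall into the hole, and this forces [x']
    and [y'] to be swallowed at that same last step.  So their distance is less
    than [1 / (n + 1)] for every [n], which is absurd.

    For [kappa] equal to [omega_1] the set [D] is countable, so [K] is
    metrisable. *)

(** * Cardinalities *)

Lemma card_leTP (W T : Type) (A : set T) :
  [set: W] #<= A <-> exists2 f : W -> T, injective f & forall w, A (f w).
Proof.
split=> [/card_leP[f]|[f finj fA]].
  pose i (w : W) : [set: W] := SigSub (mem_set (I : [set: W] w)).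
  exists (fun w => set_val (f (i w))) => [v w /val_inj /inj fvw|w].
    by have /(congr1 set_val) := fvw (mem_set I) (mem_set I).
  exact/set_mem/valP.
have finj' : {in [set: W] &, injective f} by move=> v w _ _ /finj.
rewrite -(card_le_eql (inj_card_eq finj')); apply: subset_card_le.
by move=> _ [w _ <-].
Qed.

(** Cardinals are well founded.  A set [S] of points of the product of the
    [X i] on which every projection is injective can be enlarged by a point
    avoiding the coordinates used so far, unless one of the projections is
    onto; so a maximal such [S] has the cardinality of some [X i], and its
    other projections inject that [X i] into every [X j]. *)
Lemma exists_min_card (I : Type) (T : I -> Type) (X : forall i, set (T i))
  (i0 : I) : exists i, forall j, X i #<= X j.
Proof.
apply: contrapT => noMin.
have larger i : exists j, ~ (X i #<= X j).
  by apply: contrapT => noj; apply: noMin; exists i => j; apply: contrapT => ij;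
    apply: noj; exists j.
pose P (S : set (forall i, T i)) := (forall f, S f -> forall i, X i (f i)) /\
  (forall f g, S f -> S g -> forall i, f i = g i -> f = g).
have [F FP Ftot|S [[SX Sinj] Smax]] := @Zorn_bigcup _ P.
  split=> [f [S FS Sf] i|f g [S FS Sf] [S' FS' Sg] i].
    exact: (FP S FS).1.
  have [SS'|S'S] := Ftot _ _ FS FS'.
    exact: ((FP S' FS').2 _ _ (SS' _ Sf) Sg i).
  exact: ((FP S FS).2 _ _ Sf (S'S _ Sg) i).
have fresh i : exists x, X i x /\ forall f, S f -> f i <> x.
  apply: contrapT => nox; have [j] := larger i; apply.
  have XiS : X i `<=` (fun f => f i) @` S.
    move=> x Xx; apply: contrapT => nof; apply: nox; exists x; split => // f Sf fx.
    by apply: nof; exists f.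
  apply: card_le_trans (subset_card_le XiS) _.
  apply: card_le_trans (card_image_le _ _) _.
  have Sj : {in S &, injective (fun f : forall i, T i => f j)}.
    by move=> f g /set_mem Sf /set_mem Sg; exact: Sinj.
  rewrite -(card_le_eql (inj_card_eq Sj)); apply: subset_card_le.
  by move=> _ [f Sf <-]; exact: SX.
pose h i := projT1 (cid (fresh i)).
have hP i : X i (h i) /\ forall f, S f -> f i <> h i by exact: projT2 (cid (fresh i)).
apply: (Smax (S `|` [set h])).
  split; last by move=> /(_ h (or_intror erefl)) Sh; exact: (hP i0).2 _ Sh erefl.
  by move=> f Sf; left.
split=> [f [/SX//|-> i]|f g [Sf|->] [Sg|->] i //].
- exact: (hP i).1.
- exact: Sinj.
- by move/(hP i).2 => /(_ Sf).
- by move/esym/(hP i).2 => /(_ Sg).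
Qed.

Lemma card_le_total (T U : Type) (A : set T) (B : set U) : A #<= B \/ B #<= A.
Proof.
pose V (b : bool) : Type := if b then T else U.
pose X (b : bool) : set (V b) := if b return set (V b) then A else B.
have [[] bmin] := @exists_min_card bool V X true.
  by left; exact: (bmin false).
by right; exact: (bmin true).
Qed.

(** The weight is attained, because cardinals are well founded. *)
Lemma exists_weight_basis (T : topologicalType) :
  exists B : set (set T), weight_basis B.
Proof.
have openB : basis (@open T).
  split=> // x U; rewrite nbhsE => -[V [oV Vx] VU].
  by exists V => //; split.
have [[B bB] Bmin] :=
  @exists_min_card {B | basis B} (fun=> set T) (fun B => sval B) (exist _ _ openB).
by exists B; split=> // C bC; exact: (Bmin (exist _ C bC)).
Qed.

(** Absence of an injection from [W]; since cardinals are comparable this is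
    strict inequality of cardinals ([fewer_card_lt]), but in this form it
    passes to smaller sets at once. *)
Definition fewer (W T : Type) (A : set T) := ~ ([set: W] #<= A).

Lemma fewer_card_lt (W T : Type) (A : set T) :
  fewer W A <-> card_lt A [set: W].
Proof.
split=> [WA|[AW AnW] WA].
  have [AW|//] := card_le_total A [set: W].
  by split=> //; apply/negP => /card_eqPle[].
by move/negP: AnW; apply; apply/card_eqPle.
Qed.

Lemma fewer_le (W T U : Type) (A : set T) (B : set U) :
  A #<= B -> fewer W B -> fewer W A.
Proof. by move=> AB WB WA; apply: WB; exact: card_le_trans WA AB. Qed.

(** * Well-ordered types and regular cardinals *)

Lemma wo_min (dW : Order.disp_t) (W : orderType dW) (P : set W) :
  wochoice.well_order (<=%O : rel W) -> P !=set0 ->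
  exists2 w, P w & forall v, P v -> (w <= v)%O.
Proof.
move=> Wwo [x Px].
have [|w [[Pw wmin] _]] := Wwo (mem P); first by exists x; rewrite inE.
exists w; first by move: Pw; rewrite inE.
by move=> v Pv; apply: wmin; rewrite inE.
Qed.

Lemma wo_lt_wf (dW : Order.disp_t) (W : orderType dW) :
  wochoice.well_order (<=%O : rel W) -> well_founded (fun v w : W => (v < w)%O).
Proof.
move=> Wwo w; apply: contrapT => nAcc.
have [|x xP xmin] := @wo_min _ W [set x | ~ Acc (fun v w => (v < w)%O) x] Wwo.
  by exists w.
apply: xP; constructor=> y yx; apply: contrapT => /xmin.
by rewrite leNgt yx.
Qed.

(** Transfinite recursion along [W]: if every [r]-sequence in [P] that is
    indexed by a proper initial segment can be continued, then there is one
    indexed by all of [W]. *)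
Lemma wo_embedding (dW : Order.disp_t) (W : orderType dW) (T : choiceType)
    (t0 : T) (r : T -> T -> Prop) (P : set T) :
  wochoice.well_order (<=%O : rel W) ->
  (forall (w : W) (f : W -> T), (forall v, (v < w)%O -> P (f v)) ->
     exists2 z, P z & forall v, (v < w)%O -> r (f v) z) ->
  exists f : W -> T,
    (forall w, P (f w)) /\ (forall v w, (v < w)%O -> r (f v) (f w)).
Proof.
move=> Wwo next.
have wf := wo_lt_wf Wwo.
pose G (w : W) (f : forall v : W, (v < w)%O -> T) : T :=
  xget t0 [set z | P z /\ forall (v : W) (vw : (v < w)%O), r (f v vw) z].
pose f := Fix wf (fun=> T) G.
have fE w : f w = xget t0 [set z | P z /\ forall v, (v < w)%O -> r (f v) z].
  rewrite /f Fix_eq // => x g h gh.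
  suff -> : g = h by [].
  by apply/functional_extensionality_dep => v; apply/funext => vx; exact: gh.
have fP w : P (f w) /\ forall v, (v < w)%O -> r (f v) (f w).
  elim/(well_founded_ind wf) : w => w IH.
  have [v vw|z Pz zP] := next w f; first by have [] := IH v vw.
  have ex : exists z, [set z | P z /\ forall v, (v < w)%O -> r (f v) z] z.
    by exists z.
  by have := xgetPex t0 ex; rewrite -fE.
by exists f; split=> [w|v w]; have [] := fP w => // _; exact.
Qed.

Section regular.
Context (dW : Order.disp_t) (W : orderType dW).
Hypothesis Wreg : regular_uncountable_cardinal W.

Lemma regular_wo : wochoice.well_order (<=%O : rel W).
Proof. by have [[]] := Wreg. Qed.

Lemma fewer_bounded (A : set W) :
  fewer W A -> exists w, forall a, A a -> (a < w)%O.
Proof.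
move=> WA; apply: contrapT => unb; apply: WA.
have [_ _ Wcof] := Wreg.
suff /Wcof/card_eqPle[] : cofinal A by [].
move=> w; apply: contrapT => now; apply: unb; exists w => a Aa.
by rewrite ltNge; apply/negP => wa; apply: now; exists a.
Qed.

Lemma fewer_segment (w : W) : fewer W [set v : W | (v < w)%O].
Proof. by apply/fewer_card_lt; have [[_]] := Wreg. Qed.

Lemma fewer_countable (T : Type) (A : set T) : countable A -> fewer W A.
Proof.
by move=> cA WA; have [_ + _] := Wreg; apply; exact: card_le_trans WA cA.
Qed.

(** An injection of [W] into the union splits [W] into pieces [c w = i] that
    are bounded, as each embeds into one [F i].  The bounds are indexed by [D],
    so they are bounded too, and an upper bound of all of them would have to
    lie below itself. *)
Lemma fewer_bigcup (I T : Type) (D : set I) (F : I -> set T) :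
  fewer W D -> (forall i, D i -> fewer W (F i)) ->
  fewer W (\bigcup_(i in D) F i).
Proof.
move=> WD WF /card_leTP[g ginj gF].
have /choice[c cP] : forall w, exists i, D i /\ F i (g w).
  by move=> w; have [i Di Fi] := gF w; exists i.
have [w0 _] := fewer_bounded (fewer_countable (@countable0 W)).
have /choice[s sP] : forall i, exists b, D i -> forall w, c w = i -> (w < b)%O.
  move=> i; have [Di|nDi] := pselect (D i); last first.
    by exists w0.
  have [|b bP] := @fewer_bounded [set w | c w = i]; last by exists b.
  apply: fewer_le (WF _ Di).
  have gi : {in [set w | c w = i] &, injective g} by move=> ? ? _ _ /ginj.
  rewrite -(card_le_eql (inj_card_eq gi)); apply: subset_card_le.
  by move=> _ [w <- <-]; exact: (cP w).2.
have [|w wP] := @fewer_bounded (s @` D); first exact: fewer_le (card_image_le _ _) WD.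
have [Dw _] := cP w.
have := lt_trans (sP _ Dw w erefl) (wP _ (ex_intro2 _ _ _ Dw erefl)).
by rewrite ltxx.
Qed.

End regular.

(** Countable subsets of [omega_1] are bounded, because a countable union of
    countable segments is not everything; so recursion along [omega_1] embeds
    it increasingly into any cofinal subset. *)
Lemma omega1_regular (dW : Order.disp_t) (W : orderType dW) :
  is_omega1 W -> regular_uncountable_cardinal W.
Proof.
move=> [Wwo Wunc Wseg]; split=> //.
  split=> // w; split; first exact: card_leT.
  by apply/negP => /card_eqPle[_ Ww]; apply: Wunc; exact: card_le_trans Ww (Wseg w).
move=> A Acof; apply/card_eqPle; split; first exact: card_leT.
have [w0 _] : [set: W] !=set0.
  by apply/set0P/eqP => W0; apply: Wunc; rewrite W0; exact: countable0.
have [w f fA|f [fA finc]] := @wo_embedding _ W W w0 (fun v w => (v < w)%O) A Wwo.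
  pose B := \bigcup_(v in [set v | (v < w)%O]) ([set u | (u < f v)%O] `|` [set f v]).
  have [u Bu] : exists u, ~ B u.
    apply: contrapT => allB; apply: Wunc.
    suff cB : countable B.
      apply: sub_countable cB; apply: subset_card_le => u _.
      by apply: contrapT => Bu; apply: allB; exists u.
    apply: bigcup_countable => // v _; rewrite -bigcup2E.
    apply: bigcup_countable => // -[|[|n]] _ //=.
  have [a Aa ua] := Acof u; exists a => // v vw; apply: lt_le_trans ua.
  rewrite ltNge; apply/negP; rewrite le_eqVlt => ufv; apply: Bu; exists v => //.
  by case/predU1P: ufv => [->|?]; [right|left].
apply/card_leTP; exists f => // v w fvw; apply/eqP.
by case: ltgtP => // /finc; rewrite fvw ltxx.
Qed.

Section regular_sets.
Context (dW : Order.disp_t) (W : orderType dW).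
Hypothesis Wreg : regular_uncountable_cardinal W.

Lemma fewer_setU (T : Type) (A B : set T) :
  fewer W A -> fewer W B -> fewer W (A `|` B).
Proof.
move=> WA WB; rewrite -bigcup2E; apply: fewer_bigcup => //.
  by apply: fewer_countable.
by move=> [|[|n]] _ //=; apply: fewer_countable => //; exact: countable0.
Qed.

(** A Loewenheim-Skolem argument: a regular uncountable cardinal absorbs
    countably many closing-off steps. *)
Lemma fewer_closure (T : Type) (D0 : set T) (S : T -> T -> set T) :
  fewer W D0 -> (forall x y, fewer W (S x y)) ->
  exists D : set T, [/\ fewer W D, D0 `<=` D &
    forall x y, D x -> D y -> S x y `<=` D].
Proof.
move=> WD0 WS.
pose step E := E `|` \bigcup_(x in E) \bigcup_(y in E) S x y.
pose E n := iter n step D0.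
have WE n : fewer W (E n).
  elim: n => //= n IH; apply: fewer_setU => //.
  by apply: fewer_bigcup => // x _; apply: fewer_bigcup.
have Emon m n : (m <= n)%N -> E m `<=` E n.
  elim: n => [|n IH]; first by rewrite leqn0 => /eqP ->.
  by rewrite leq_eqVlt => /predU1P[-> //|/IH mn x /mn]; left.
exists (\bigcup_n E n); split.
- by apply: fewer_bigcup => //; exact: fewer_countable.
- by move=> x D0x; exists 0%N.
move=> x y [m _ Ex] [n _ Ey] z Sz; exists (maxn m n).+1 => //; right.
exists x; first by apply: Emon Ex; exact: leq_maxl.
by exists y => //; apply: Emon Ey; exact: leq_maxr.
Qed.

(** The only use of the absence of chains of type [W]: otherwise, from a set
    without small dominating subset one would pick such a chain by
    recursion. *)
Lemma fewer_dominating (T : choiceType) (r : T -> T -> Prop) (P : set T) :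
  ~ (exists f : W -> T, forall v w, (v < w)%O -> r (f v) (f w)) ->
  exists A : set T, [/\ fewer W A, A `<=` P &
    forall z, P z -> exists2 a, A a & ~ r a z].
Proof.
move=> nochain; apply: contrapT => undom.
have next A : fewer W A -> A `<=` P -> exists2 z, P z & forall a, A a -> r a z.
  move=> WA AP; apply: contrapT => noz; apply: undom; exists A; split=> // z Pz.
  apply: contrapT => noa; apply: noz; exists z => // a Aa.
  by apply: contrapT => raz; apply: noa; exists a.
have [|//|t0 _ _] := next set0; first exact/fewer_countable/countable0.
have [w f fP|f [_ fr]] := wo_embedding t0 (r := r) (P := P) (regular_wo Wreg).
  have [|_ [v vw <-]|z Pz zP] := next (f @` [set v : W | (v < w)%O]).
  - exact: fewer_le (card_image_le _ _) (@fewer_segment _ _ Wreg w).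
  - exact: fP.
  - by exists z => // v vw; apply: zP; exists v.
by apply: nochain; exists f.
Qed.

End regular_sets.

(** * Towers of open sets and fragmentation *)

Section tower.
Context (T : Type) (g : set T -> set T).
Hypothesis g_ext : forall U, U `<=` g U.

(** The sets reached from the empty union by transfinitely iterating [g] and
    taking unions at limits; an inductive predicate replaces the ordinals that
    would index the iteration. *)
Inductive tower : set T -> Prop :=
| tower_succ U : tower U -> tower (g U)
| tower_bigcup (F : set (set T)) :
    (forall U, F U -> tower U) -> tower (\bigcup_(U in F) U).

(** The Bourbaki-Witt argument.  Call [V] extreme if every member strictly
    inside [V] has its successor inside [V].  An extreme [V] is comparable with
    every member, with nothing strictly between [V] and [g V]; this comparison
    is what makes extremality pass to successors and unions, so all members
    are extreme. *)
Lemma tower_linear U V : tower U -> tower V -> U `<=` V \/ g V `<=` U.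
Proof.
pose extreme V := forall U, tower U -> U `<=` V -> U = V \/ g U `<=` V.
have cmp X : extreme X -> forall Y, tower Y -> Y `<=` X \/ g X `<=` Y.
  move=> eX Y; elim=> {Y} [Y tY [YX|XY]|F tF IH].
  - by have [->|] := eX _ tY YX; [right|left].
  - by right; exact: subset_trans (@g_ext Y).
  - have [FX|] := pselect (forall Y, F Y -> Y `<=` X).
      by left => x [Y FY Yx]; exact: (FX Y).
    move=> /existsNP[Y /not_implyP[FY nYX]]; right.
    have [//|XY] := IH Y FY.
    by move=> x /XY Yx; exists Y.
have allextreme X : tower X -> extreme X.
  elim=> {X} [X tX eX|F tF eF] Y tY YX.
  - have [YX'|] := cmp X eX Y tY; last by left; exact/seteqP.
    have [->|gYX] := eX Y tY YX'; first by right.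
    by right; exact: subset_trans gYX (@g_ext X).
  - have [[Z FZ nZY]|] := pselect (exists2 Z, F Z & ~ Z `<=` Y); last first.
      move=> allY; left; apply/seteqP; split=> // x [Z FZ Zx].
      by apply: contrapT => nYx; apply: allY; exists Z => // /(_ x Zx).
    have ZF : Z `<=` \bigcup_(U in F) U by move=> x Zx; exists Z.
    have [YZ|] := cmp Z (eF Z FZ) Y tY; last first.
      by move=> gZY; exfalso; apply: nZY; exact: subset_trans (@g_ext Z) gZY.
    have [YZE|gYZ] := eF Z FZ Y tY YZ; last by right; exact: subset_trans gYZ ZF.
    by exfalso; apply: nZY; rewrite YZE.
by move=> tU tV; exact: cmp (allextreme V tV) U tU.
Qed.

End tower.

Lemma diameter_lt (R : realType) (T : Type) (d : T -> T -> R) (A : set T)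
    (e : R) x y : (diameter d A < e%:E)%E -> A x -> A y -> (d x y < e)%R.
Proof.
move=> Ae Ax Ay; rewrite -lte_fin; apply: le_lt_trans Ae.
by apply: ereal_sup_ubound; exists x => //; exists y.
Qed.

(** Exhaust [K] by a transfinite increasing tower of open sets in which each
    step adds a piece of diameter below [e].  A compact nonempty [C] is first
    swallowed at a successor step: [V C] is the last member of the tower that
    does not contain it, and [U] the next one.  Any compact set between [C]
    and [U] is swallowed at the same step.  This stability allows the step of
    [C] to be recovered from a slightly larger interval with known
    endpoints. *)
Lemma fragmentation_cells (R : realType) (K : topologicalType)
    (d : K -> K -> R) (e : R) :
  (forall M : set K, M !=set0 -> exists U,
     [/\ open U, M `&` U !=set0 & (diameter d (M `&` U) < e%:E)%E]) ->
  exists V : set K -> set K, forall C : set K, compact C -> C !=set0 ->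
    open (V C) /\ exists U : set K,
    [/\ open U, ~ (C `<=` V C), C `<=` U,
        (forall C', compact C' -> C `<=` C' -> C' `<=` U -> V C' = V C) &
        forall x y, U x -> U y -> ~ V C x -> ~ V C y -> (d x y < e)%R].
Proof.
move=> frag.
have /choice[h hP] : forall V : set K, exists U : set K, V != setT ->
    [/\ open U, ~` V `&` U !=set0 & (diameter d (~` V `&` U) < e%:E)%E].
  move=> V; have [->|VT] := eqVneq V setT; first by exists setT.
  have [|U UP] := frag (~` V); last by exists U.
  by apply/set0P; apply: contra VT => /eqP V0; rewrite -(setCK V) V0 setC0.
pose g V : set K := V `|` (if V == setT then set0 else h V).
have gext V : V `<=` g V by move=> x; left.
have topen V : tower g V -> open V.
  elim=> {V} [V _ oV|F _ oF]; last exact: bigcup_open.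
  apply: openU => //; case: eqVneq => [_|VT]; first exact: open0.
  by have [] := hP V VT.
pose below (C : set K) := [set U | tower g U /\ ~ C `<=` U].
pose V C := \bigcup_(U in below C) U.
have tV C : tower g (V C) by apply: tower_bigcup => U [].
exists V => C cC [c Cc]; split; first exact/topen.
have nCV : ~ C `<=` V C.
  (* The traces on C of the complements of members of the tower form a chain of
     nonempty closed sets, so by compactness they have a common point. *)
  move=> CV; pose F := filter_from (below C) (fun U => C `\` U).
  have FF : ProperFilter F.
    apply: filter_from_proper; last first.
      move=> U [_ nCU]; apply: contrapT => CU0; apply: nCU => x Cx.
      by apply: contrapT => nUx; apply: CU0; exists x.
    apply: filter_from_filter.
      exists (\bigcup_(U in set0) U); split; first by apply: tower_bigcup.
      by move/(_ c Cc) => [].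
    move=> U U' [tU nCU] [tU' nCU'].
    have [UU'|] := tower_linear gext tU tU'.
      by exists U' => // x [Cx nU'x]; split; split=> // /UU'.
    move=> /(subset_trans (gext U')) U'U.
    by exists U => // x [Cx nU'x]; split; split=> // /U'U.
  have [|x [Cx clx]] := cC F FF.
    by exists (\bigcup_(U in set0) U); [split; [exact: tower_bigcup|by move/(_ c Cc) => []]|move=> x []].
  have [U [tU nCU] Ux] := CV x Cx.
  have [y [[_ nUy] Uy]] : (C `\` U) `&` U !=set0.
    apply: clx; first by exists U.
    by apply: open_nbhs_nbhs; split=> //; exact: topen.
  exact: nUy Uy.
have VT : V C != setT by apply/eqP => VT; apply: nCV; rewrite VT.
have [oh [z [nVz hz]] hdiam] := hP (V C) VT.
have gE : g (V C) = V C `|` h (V C) by rewrite /g (negbTE VT).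
exists (g (V C)); split=> //.
- exact/topen/tower_succ.
- apply: contrapT => nCg; apply: nVz; exists (g (V C)); last by rewrite gE; right.
  by split=> //; exact: tower_succ.
- move=> C' cC' CC' C'g; apply/seteqP; split=> x [U [tU nU] Ux].
    have [UV|gU] := tower_linear gext tU (tV C); first exact: UV.
    by case: nU; exact: subset_trans C'g gU.
  by exists U => //; split=> // C'U; apply: nU; exact: subset_trans CC' C'U.
- rewrite gE => x y [//|hx] [//|hy] nx ny; exact: diameter_lt hdiam _ _.
Qed.

(** * Compact linearly ordered spaces *)

(** Every gap [x < y] is witnessed by a point of [D] in [x, y[ and by one in
    ]x, y]; equivalently, [D] meets ]x, y[ or contains both [x] and [y].  In
    an order topology this is what makes the open intervals with endpoints in
    [D] a basis; density alone would lose the jumps. *)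
Definition order_separating (dK : Order.disp_t) (K : orderType dK)
    (D : set K) :=
  forall x y, (x < y)%O ->
    (exists2 a, D a & (x <= a < y)%O) /\ (exists2 b, D b & (x < b <= y)%O).

Section compact_order.
Context (dK : Order.disp_t) (K : orderTopologicalType dK).
Hypothesis Kcompact : compact [set: K].

(** The final segments [a, +oo[ with [a] in [A] trace on [A] a filter base of
    closed sets, and a common point is a greatest element. *)
Lemma closed_has_max (A : set K) : closed A -> A !=set0 ->
  exists2 m, A m & forall a, A a -> (a <= m)%O.
Proof.
move=> cA [a0 Aa0].
pose F := filter_from A (fun a => A `&` `[a, +oo[%classic).
have FF : ProperFilter F.
  apply: filter_from_proper; last first.
    by move=> a Aa; exists a; split=> //; rewrite /= in_itv /= lexx.
  apply: filter_from_filter; first by exists a0.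
  move=> a b Aa Ab; exists (Order.max a b); first by case: (leP a b).
  move=> x [Ax]; rewrite /= in_itv /= andbT ge_max => /andP[ax bx].
  by split; split=> //; rewrite /= in_itv /= ?ax ?bx.
have cAc : compact A by apply: subclosed_compact Kcompact _.
have [|m [Am clm]] := cAc F FF; first by exists a0 => // x [].
exists m => // a Aa.
have : closure `[a, +oo[%classic m.
  move=> U mU; have [x [[_ ax] Ux]] : (A `&` `[a, +oo[%classic) `&` U !=set0.
    by apply: clm => //; exists a.
  by exists x.
by rewrite -(closure_id _).1 /= ?in_itv /= ?andbT//; exact: rray_closed.
Qed.

Lemma closed_has_min (A : set K) : closed A -> A !=set0 ->
  exists2 m, A m & forall a, A a -> (m <= a)%O.
Proof.
move=> cA [a0 Aa0].
pose F := filter_from A (fun a => A `&` `]-oo, a]%classic).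
have FF : ProperFilter F.
  apply: filter_from_proper; last first.
    by move=> a Aa; exists a; split=> //; rewrite /= in_itv /= lexx.
  apply: filter_from_filter; first by exists a0.
  move=> a b Aa Ab; exists (Order.min a b); first by case: (leP a b).
  move=> x [Ax]; rewrite /= in_itv /= le_min => /andP[ax bx].
  by split; split=> //; rewrite /= in_itv /= ?ax ?bx.
have cAc : compact A by apply: subclosed_compact Kcompact _.
have [|m [Am clm]] := cAc F FF; first by exists a0 => // x [].
exists m => // a Aa.
have : closure `]-oo, a]%classic m.
  move=> U mU; have [x [[_ ax] Ux]] : (A `&` `]-oo, a]%classic) `&` U !=set0.
    by apply: clm => //; exists a.
  by exists x.
by rewrite -(closure_id _).1 /= ?in_itv /= ?andbT//; exact: lray_closed.
Qed.

Lemma itv_convex (i : interval K) (a b c : K) :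
  a \in i -> c \in i -> (a <= b)%O -> (b <= c)%O -> b \in i.
Proof.
case: i => l u; rewrite !itv_boundlr => /andP[la _] /andP[_ cu] ab bc.
by rewrite (le_trans la) ?(le_trans _ cu) // bnd_simp.
Qed.

(** A point [x] of the closure of [D] with no point of [D] immediately to its
    right is approached by [D] from the left. *)
Lemma closure_left_limit (D U : set K) (x y : K) : (x < y)%O ->
  (forall z, D z -> (x < z)%O -> (y <= z)%O) -> closure D x -> ~ D x ->
  open U -> U x ->
  exists p, [/\ D p, (p < x)%O & forall z, (p <= z)%O -> (z <= x)%O -> U z].
Proof.
move=> xy gap Dx nDx oU Ux.
have : nbhs x U by exact: open_nbhs_nbhs.
rewrite itv_nbhsE => -[i [oi xi] iU].
have [|p [Dp [pi py]]] := Dx ([set` i] `&` `]-oo, y[%classic).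
  apply: open_nbhs_nbhs; split; last by split=> //=; rewrite in_itv.
  by apply: openI; [exact: itv_open_ends_open|exact: lray_open].
have px : (p < x)%O.
  rewrite lt_neqAle; apply/andP; split; first by apply/eqP => E; rewrite -E in nDx.
  rewrite leNgt; apply/negP => /(gap _ Dp); apply/negP; rewrite -ltNge.
  by move: py; rewrite /= in_itv.
by exists p; split=> // z pz zx; apply: iU; exact: itv_convex pz zx.
Qed.

Lemma closure_right_limit (D U : set K) (x y : K) : (x < y)%O ->
  (forall z, D z -> (z < y)%O -> (z <= x)%O) -> closure D y -> ~ D y ->
  open U -> U y ->
  exists q, [/\ D q, (y < q)%O & forall z, (y <= z)%O -> (z <= q)%O -> U z].
Proof.
move=> xy gap Dy nDy oU Uy.
have : nbhs y U by exact: open_nbhs_nbhs.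
rewrite itv_nbhsE => -[i [oi yi] iU].
have [|q [Dq [qi xq]]] := Dy ([set` i] `&` `]x, +oo[%classic).
  apply: open_nbhs_nbhs; split; last by split=> //=; rewrite in_itv /= andbT.
  by apply: openI; [exact: itv_open_ends_open|exact: rray_open].
have yq : (y < q)%O.
  rewrite lt_neqAle; apply/andP; split; first by apply/eqP => E; rewrite E in nDy.
  rewrite leNgt; apply/negP => /(gap _ Dq); apply/negP; rewrite -ltNge.
  by move: xq; rewrite /= in_itv /= andbT.
by exists q; split=> // z yz zq; apply: iU; exact: itv_convex yz zq.
Qed.

Lemma countable_subsingleton (T : Type) (A : set T) :
  (forall a b, A a -> A b -> a = b) -> countable A.
Proof.
move=> A1; have [->|/set0P[a Aa]] := eqVneq A set0; first exact: countable0.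
suff -> : A = [set a] by [].
by apply/seteqP; split=> [b Ab|_ ->//]; exact: A1.
Qed.

Context (R : realType) (dW : Order.disp_t) (W : orderType dW).
Hypotheses (Kfrag : fragmentable R K) (Wreg : regular_uncountable_cardinal W)
  (nocopy : ~ contains_copy W K).

Lemma fewer_cofinal (y : K) : exists A : set K, [/\ fewer W A,
  forall a, A a -> (a < y)%O & forall z, (z < y)%O -> exists2 a, A a & (z <= a)%O].
Proof.
have [[f fS]|A [WA AP Adom]] :=
  @fewer_dominating _ _ Wreg K (fun a z => (a < z)%O) [set z | (z < y)%O].
  by apply: nocopy; left; exists f; apply: le_mono => v w; exact: fS.
by exists A; split=> // z /Adom[a Aa /negP]; rewrite -leNgt; exists a.
Qed.

Lemma fewer_coinitial (y : K) : exists A : set K, [/\ fewer W A,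
  forall a, A a -> (y < a)%O & forall z, (y < z)%O -> exists2 a, A a & (a <= z)%O].
Proof.
have [[f fS]|A [WA AP Adom]] :=
  @fewer_dominating _ _ Wreg K (fun a z => (z < a)%O) [set z | (y < z)%O].
  by apply: nocopy; right; exists f; apply: le_nmono => v w; exact: fS.
by exists A; split=> // z /Adom[a Aa /negP]; rewrite -leNgt; exists a.
Qed.

(** [D] is obtained by closing off the endpoints of [K] under small cofinal
    subsets of ]-oo, p[ and small coinitial subsets of ]p, +oo[, and under
    the extreme points of the sets [F n p q], the part of [p, q] that is left
    when [p, q] is last not swallowed by the [n]-th tower.  Suppose the gap
    [x < y] is not witnessed, and let [x', y'] be the hole of the closure of
    [D] around it.  If [x'] or [y'] belonged to [D], the cofinal and coinitial
    sets would bring [x] and [y] into [D].  So both are limits of [D] from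
    outside the hole, and the hole can be slightly enlarged to an interval
    [p, q] with ends in [D] that is swallowed at the same step, by the set [U]
    following [V].  If [x'] were in [V], then [p] could be chosen with
    [p, x'] inside [V], and the least point of [p, q] outside [V] would be
    a point of [D] in the hole; likewise for [y'].  Hence [x'] and [y'] both
    lie in [U] minus [V], whose diameter is too small. *)
Lemma exists_separating_set : exists2 D : set K, fewer W D & order_separating D.
Proof.
have [d dmet frag] := Kfrag.
have /choice[V VP] : forall n : nat, exists V : set K -> set K,
    forall C, compact C -> C !=set0 -> open (V C) /\ exists U : set K,
    [/\ open U, ~ (C `<=` V C), C `<=` U,
        (forall C', compact C' -> C `<=` C' -> C' `<=` U -> V C' = V C) &
        forall x y, U x -> U y -> ~ V C x -> ~ V C y -> (d x y < n.+1%:R^-1)%R].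
  by move=> n; apply: fragmentation_cells => M M0; exact: frag.
have [lo loP] := choice fewer_cofinal.
have [up upP] := choice fewer_coinitial.
pose F n p q := `[p, q]%classic `\` V n `[p, q]%classic.
pose minF n p q := [set m | F n p q m /\ forall z, F n p q z -> (m <= z)%O].
pose maxF n p q := [set m | F n p q m /\ forall z, F n p q z -> (z <= m)%O].
pose S p q := (lo p `|` up p) `|` \bigcup_n (minF n p q `|` maxF n p q).
pose D0 := [set m : K | forall z : K, (m <= z)%O] `|` [set m | forall z : K, (z <= m)%O].
have min1 (A : set K) : countable [set m : K | A m /\ forall z, A z -> (m <= z)%O].
  apply: countable_subsingleton => a b [Aa amin] [Ab bmin].
  by apply/le_anti; rewrite amin ?bmin.
have max1 (A : set K) : countable [set m : K | A m /\ forall z, A z -> (z <= m)%O].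
  apply: countable_subsingleton => a b [Aa amax] [Ab bmax].
  by apply/le_anti; rewrite amax ?bmax.
have WD0 : fewer W D0.
  apply: (fewer_setU Wreg).
    apply: (fewer_countable Wreg); apply: countable_subsingleton => a b /= aP bP.
    by apply/le_anti; rewrite aP bP.
  apply: (fewer_countable Wreg); apply: countable_subsingleton => a b /= aP bP.
  by apply/le_anti; rewrite aP bP.
have WS p q : fewer W (S p q).
  apply: (fewer_setU Wreg).
    by apply: (fewer_setU Wreg); [have [] := loP p|have [] := upP p].
  apply: (fewer_bigcup Wreg); first exact: fewer_countable.
  move=> n _; apply: (fewer_setU Wreg).
    exact: (fewer_countable Wreg (min1 (F n p q))).
  exact: (fewer_countable Wreg (max1 (F n p q))).
have [D [WD D0D SD]] := fewer_closure Wreg WD0 WS.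
have loD y a : D y -> lo y a -> D a by move=> Dy ya; apply: (SD y y) => //; left; left.
have upD y a : D y -> up y a -> D a by move=> Dy ya; apply: (SD y y) => //; left; right.
have minD n p q m : D p -> D q -> minF n p q m -> D m.
  by move=> Dp Dq mP; apply: (SD p q) => //; right; exists n => //; left.
have maxD n p q m : D p -> D q -> maxF n p q m -> D m.
  by move=> Dp Dq mP; apply: (SD p q) => //; right; exists n => //; right.
exists D => // x y xy.
suff [[z Dz /andP[xz zy]]|[Dx Dy]] : (exists2 z, D z & (x < z < y)%O) \/ (D x /\ D y).
- by split; exists z; rewrite // ?xz ?zy ?ltW.
- by split; [exists x|exists y]; rewrite // ?lexx xy.
have [|nz] := pselect (exists2 z, D z & (x < z < y)%O); [by left|right].
(* The hole of the closure of D around the gap; the endpoints of K in D ensure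
   that it is bounded on both sides. *)
have [x' [clx' x'x] x'max] : exists2 x', (closure D `&` `]-oo, x]%classic) x' &
    forall z, (closure D `&` `]-oo, x]%classic) z -> (z <= x')%O.
  apply: closed_has_max.
    by apply: closedI; [exact: closed_closure|exact: lray_closed].
  have [|m _ mmin] := @closed_has_min setT closedT; first by exists x.
  exists m; split; last by rewrite /= in_itv /= mmin.
  by apply: subset_closure; apply: D0D; left => z; exact: mmin.
have [y' [cly' yy'] y'min] : exists2 y', (closure D `&` `[y, +oo[%classic) y' &
    forall z, (closure D `&` `[y, +oo[%classic) z -> (y' <= z)%O.
  apply: closed_has_min.
    by apply: closedI; [exact: closed_closure|exact: rray_closed].
  have [|m _ mmax] := @closed_has_max setT closedT; first by exists x.
  exists m; split; last by rewrite /= in_itv /= mmax.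
  by apply: subset_closure; apply: D0D; right => z; exact: mmax.
move: x'x yy'; rewrite /= !in_itv /= andbT => x'x yy'.
have gapr z : D z -> (x' < z)%O -> (y' <= z)%O.
  move=> Dz x'z; apply: y'min; split; first exact: subset_closure.
  rewrite /= in_itv /= andbT leNgt; apply/negP => zy; apply: nz; exists z => //.
  rewrite zy andbT ltNge; apply/negP => zx.
  move: x'z; rewrite ltNge x'max //; split; first exact: subset_closure.
  by rewrite /= in_itv.
have gapl z : D z -> (z < y')%O -> (z <= x')%O.
  by move=> Dz zy'; rewrite leNgt; apply/negP => /(gapr _ Dz); rewrite leNgt zy'.
have x'y' : (x' < y')%O by exact: le_lt_trans x'x (lt_le_trans xy yy').
have Dx'y : D x' -> y = y' /\ D y.
  move=> Dx'; have [_ upx' upcof] := upP x'.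
  have [a ua ay] := upcof y (le_lt_trans x'x xy).
  have Da := upD _ _ Dx' ua.
  have y'a := gapr _ Da (upx' _ ua).
  have ya : y = a by apply/le_anti; rewrite ay (le_trans yy' y'a).
  by split; [apply/le_anti; rewrite yy' (le_trans y'a ay)|rewrite ya].
have Dy'x : D y' -> x = x' /\ D x.
  move=> Dy'; have [_ loy' locof] := loP y'.
  have [a la xa] := locof x (lt_le_trans xy yy').
  have Da := loD _ _ Dy' la.
  have ax' := gapl _ Da (loy' _ la).
  have xE : x = a by apply/le_anti; rewrite xa (le_trans ax' x'x).
  by split; [apply/le_anti; rewrite x'x (le_trans xa ax')|rewrite xE].
have [/Dx'y[yE Dy]|nDx'] := pselect (D x').
  by split=> //; apply: (Dy'x _).2; rewrite -yE.
have [/Dy'x[xE Dx]|nDy'] := pselect (D y').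
  by split=> //; apply: (Dx'y _).2; rewrite -xE.
exfalso.
have dxy : (0 < d x' y')%R.
  rewrite lt_neqAle (is_metric_ge0 dmet) andbT eq_sym; apply/eqP.
  by move/(is_metric_eq0 dmet) => E; move: x'y'; rewrite E ltxx.
have [n] := ltr_add_invr dxy; rewrite add0r => nd.
have cpt p q : compact (`[p, q]%classic : set K).
  by apply: subclosed_compact Kcompact _ => //; exact: itv_closed.
pose C := `[x', y']%classic.
have [|oV [U [oU nCV CU VE Ud]]] := VP n C (cpt _ _).
  by exists x'; rewrite /C /= in_itv /= lexx ltW.
have [c Cc nVc] : exists2 c, C c & ~ V n C c.
  apply: contrapT => noc; apply: nCV => c Cc; apply: contrapT => nVc.
  by apply: noc; exists c.
have Ux' : U x' by apply: CU; rewrite /C /= in_itv /= lexx ltW.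
have Uy' : U y' by apply: CU; rewrite /C /= in_itv /= lexx ltW.
move: (Cc); rewrite /C /= in_itv /= => /andP[x'c cy'].
have VpqE p q : (p < x')%O -> (y' < q)%O ->
    (forall z, (p <= z)%O -> (z <= x')%O -> U z) ->
    (forall z, (y' <= z)%O -> (z <= q)%O -> U z) -> V n `[p, q]%classic = V n C.
  move=> px' y'q pU qU; apply: VE => // z; rewrite /C /= !in_itv /= => /andP[pz zq].
    by rewrite (le_trans (ltW px') pz) (le_trans zq (ltW y'q)).
  have [zx'|x'z] := leP z x'; first exact: pU.
  have [y'z|zy'] := leP y' z; first exact: qU.
  by apply: CU; rewrite /C /= in_itv /= !ltW.
have Fpq p q : (p < x')%O -> (y' < q)%O -> V n `[p, q]%classic = V n C ->
    F n p q c /\ closed (F n p q).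
  move=> px' y'q VpqC; split.
    split; last by rewrite VpqC.
    by rewrite /= in_itv /= (le_trans (ltW px') x'c) (le_trans cy' (ltW y'q)).
  rewrite /F setDE VpqC; apply: closedI; first exact: itv_closed.
  exact: open_closedC.
(* Otherwise the least point of F n p q would be a point of D strictly above x'
   and, being at most c, below y'. *)
have nVx' : ~ V n C x'.
  move=> Vx'.
  have [p [Dp px' pUV]] := closure_left_limit x'y' gapr clx' nDx' (openI oU oV)
    (conj Ux' Vx').
  have [q [Dq y'q qU]] := closure_right_limit x'y' gapl cly' nDy' oU Uy'.
  have VE' := VpqE p q px' y'q (fun z pz zx => (pUV z pz zx).1) qU.
  have [Fc cF] := Fpq p q px' y'q VE'.
  have [|m Fm mmin] := closed_has_min cF; first by exists c.
  have Dm : D m by exact: (minD n p q).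
  have my' : (m < y')%O.
    rewrite lt_neqAle (le_trans (mmin _ Fc) cy') andbT.
    by apply/eqP => E; rewrite -E in nDy'.
  move: Fm => [/=]; rewrite in_itv /= => /andP[pm _]; apply; rewrite VE'.
  exact: (pUV m pm (gapl _ Dm my')).2.
have nVy' : ~ V n C y'.
  move=> Vy'.
  have [p [Dp px' pU]] := closure_left_limit x'y' gapr clx' nDx' oU Ux'.
  have [q [Dq y'q qUV]] := closure_right_limit x'y' gapl cly' nDy' (openI oU oV)
    (conj Uy' Vy').
  have VE' := VpqE p q px' y'q pU (fun z yz zq => (qUV z yz zq).1).
  have [Fc cF] := Fpq p q px' y'q VE'.
  have [|m Fm mmax] := closed_has_max cF; first by exists c.
  have Dm : D m by exact: (maxD n p q).
  have x'm : (x' < m)%O.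
    rewrite lt_neqAle (le_trans x'c (mmax _ Fc)) andbT.
    by apply/eqP => E; rewrite E in nDx'.
  move: Fm => [/=]; rewrite in_itv /= => /andP[_ mq]; apply; rewrite VE'.
  exact: (qUV m (gapr _ Dm x'm) mq).2.
by have := lt_trans (Ud _ _ Ux' Uy' nVx' nVy') nd; rewrite ltxx.
Qed.

End compact_order.

(** * Bases and metrics from separating sets *)

Section separating_sets.
Context (dK : Order.disp_t) (K : orderTopologicalType dK) (D : set K).
Hypothesis Dsep : order_separating D.

Definition lower_ends : set (itv_bound K) :=
  [set -oo%O] `|` (fun a => BRight a) @` D.
Definition upper_ends : set (itv_bound K) :=
  [set +oo%O] `|` (fun b => BLeft b) @` D.
Definition separating_intervals : set (set K) :=
  \bigcup_(l in lower_ends) (fun u => [set` Interval l u]) @` upper_ends.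

Lemma separating_intervals_basis : basis separating_intervals.
Proof.
split.
  move=> _ [l lD [u uD <-]]; apply: itv_open_ends_open.
  by case: lD => [->|[a _ <-]]; case: uD => [->|[b _ <-]].
move=> x U; rewrite itv_nbhsE => -[[l u] [open_lu]].
rewrite itv_boundlr => /andP[lx xu] luU.
have [l' l'D [ll' l'x]] : exists2 l', lower_ends l' & (l <= l')%O /\ (l' <= BLeft x)%O.
  case: l lx open_lu {luU} => [[] a ax|[]//]; last first.
  - by exists -oo%O => //; left.
  - have /= [[a' Da' /andP[aa' a'x]] _] := Dsep ax.
    by exists (BRight a'); [right; exists a'|split].
  - by case: u {xu} => [[] ?|[]].
have [u' u'D [uu' xu']] : exists2 u', upper_ends u' & (u' <= u)%O /\ (BRight x <= u')%O.
  case: u xu open_lu {luU} => [[] b xb|[]//]; last first.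
  - by exists +oo%O => //; left.
  - by case: l {lx ll'} => [[] ?|[]].
  - have /= [_ [b' Db' /andP[xb' b'b]]] := Dsep xb.
    by exists (BLeft b'); [right; exists b'|split].
exists [set` Interval l' u'].
  by split; [exists l' => //; exists u'|rewrite /= itv_boundlr l'x].
move=> z; rewrite /= itv_boundlr => /andP[l'z zu']; apply: luU.
by rewrite /= itv_boundlr (le_trans ll' l'z) (le_trans zu' uu').
Qed.

Lemma fewer_separating_intervals (dW : Order.disp_t) (W : orderType dW) :
  regular_uncountable_cardinal W -> fewer W D -> fewer W separating_intervals.
Proof.
move=> Wreg WD; have W1 (T : Type) (t : T) := fewer_countable Wreg (countable1 t).
apply: (fewer_bigcup Wreg) => [|l _].
  apply: (fewer_setU Wreg); first exact: W1.
  exact: fewer_le (card_image_le _ _) WD.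
apply: fewer_le (card_image_le _ _) _.
apply: (fewer_setU Wreg); first exact: W1.
exact: fewer_le (card_image_le _ _) WD.
Qed.

End separating_sets.

Local Open Scope ring_scope.

Section metrization.
Context (R : realType) (T : topologicalType) (f : nat -> T -> R).
Hypotheses (Tcompact : compact [set: T]) (fcont : forall n, continuous (f n))
  (f01 : forall n x, 0 <= f n x <= 1)
  (finj : forall x y, (forall n, f n x = f n y) -> x = y).

Let gap n x y := `|f n x - f n y| / n.+1%:R.
Let dist x y := sup (range (fun n => gap n x y)).

Let gap_le1 n x y : gap n x y <= n.+1%:R^-1.
Proof.
rewrite /gap ler_pdivrMr ?ltr0n// mulVf ?pnatr_eq0// ler_norml.
by have /andP[? ?] := f01 n x; have /andP[? ?] := f01 n y; apply/andP; split; lra.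
Qed.

Let gap_ge0 n x y : 0 <= gap n x y.
Proof. by rewrite /gap divr_ge0. Qed.

Let gap_le_dist n x y : gap n x y <= dist x y.
Proof.
apply: ub_le_sup; last by exists n.
exists 1 => _ [m _ <-]; apply: le_trans (gap_le1 _ _ _) _.
by rewrite invf_le1 ?ltr0n// ler1n.
Qed.

Let dist_le x y (c : R) : (forall n, gap n x y <= c) -> dist x y <= c.
Proof.
move=> gc; apply: ge_sup; first by exists (gap 0 x y); exists 0%N.
by move=> _ [n _ <-].
Qed.

Let dist_metric : is_metric dist.
Proof.
have dist_ge0 x y : 0 <= dist x y by exact: le_trans (gap_ge0 0 x y) (gap_le_dist _ _ _).
have gapC n x y : gap n x y = gap n y x by rewrite /gap distrC.
split=> //.
- move=> x y; split=> [dxy|->].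
    apply: finj => n; apply/eqP; rewrite -subr_eq0 -normr_eq0.
    have := gap_le_dist n x y; rewrite dxy /gap ler_pdivrMr ?ltr0n// mul0r.
    by rewrite normr_le0 normr_eq0.
  apply/le_anti; rewrite dist_ge0 andbT; apply: dist_le => n.
  by rewrite /gap subrr normr0 mul0r.
- by move=> x y; apply/le_anti/andP; split; apply: dist_le => n; rewrite gapC.
- move=> x y z; apply: dist_le => n.
  apply: le_trans (lerD (gap_le_dist n x y) (gap_le_dist n y z)).
  by rewrite /gap -mulrDl ler_pM2r ?invr_gt0 ?ltr0n// ler_distD.
Qed.

(** Each ball contains a neighbourhood, as only finitely many of the [f n]
    contribute more than a given amount to [dist].  Conversely, if no ball
    around [x] were inside the open set [V], the sets of points outside [V] at
    small distance from [x] would cluster at some [y] outside [V], where all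
    [f n] agree with their values at [x]. *)
Lemma compact_metrizable : metrizable R T.
Proof.
exists dist; first exact: dist_metric.
move=> x; apply/seteqP; split=> [U|U [e /= e0 eU]].
  rewrite nbhsE => -[V [oV Vx] VU].
  apply: contrapT => noball.
  pose B (e : R) := [set y | dist x y < e] `\` V.
  pose F := filter_from [set e : R | 0 < e] B.
  have FF : ProperFilter F.
    apply: filter_from_proper; last first.
      move=> e e0; apply: contrapT => Be; apply: noball; exists e => // y dxy.
      by apply: VU; apply: contrapT => nVy; apply: Be; exists y.
    apply: filter_from_filter; first by exists 1 => /=.
    move=> a b /= a0 b0; exists (Num.min a b); first by rewrite /= lt_min a0.
    by move=> y [/=]; rewrite lt_min => /andP[ya yb] nVy.
  have [|y [_ cly]] := Tcompact FF; first by exists 1 => //=.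
  have nVy : ~ V y.
    move=> Vy; have [z [[_ nVz] Vz]] : B 1 `&` V !=set0; last exact: nVz.
    by apply: cly; [by exists 1 => /=|exact: open_nbhs_nbhs].
  apply: nVy; rewrite -(_ : x = y)//; apply: finj => n; apply: contrapT => fxy.
  pose c := `|f n x - f n y| / 2.
  have c0 : 0 < c by rewrite divr_gt0// normr_gt0 subr_eq0; exact/eqP.
  have [z [[/= dxz _] fyz]] : B (c / n.+1%:R) `&` [set z | `|f n y - f n z| < c] !=set0.
    apply: cly; first by exists (c / n.+1%:R) => //=; rewrite divr_gt0.
    by have /cvgrPdist_lt/(_ c c0) := @fcont n y.
  have := le_lt_trans (gap_le_dist n x z) dxz.
  rewrite /gap ltr_pM2r ?invr_gt0 ?ltr0n// => fxz.
  have := ler_distD (f n z) (f n x) (f n y).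
  by rewrite (distrC (f n z)) leNgt [X in _ < X](splitr) ltrD.
have e2 : 0 < e / 2 by rewrite divr_gt0.
have [N] := ltr_add_invr e2; rewrite add0r => Ne.
have : \forall y \near x, forall i : 'I_N.+1, `|f i x - f i y| < e / 2.
  by apply: filter_forall => i; have /cvgrPdist_lt/(_ _ e2) := @fcont i x.
apply: filterS => y yP; apply: eU => /=.
apply: (@le_lt_trans _ _ (e / 2)); last by rewrite ltr_pdivrMr// ltr_pMr// ltr1n.
apply: dist_le => n; have [nN|Nn] := ltnP n N.+1.
  apply: le_trans (ltW (yP (Ordinal nN))); rewrite /gap ler_pdivrMr ?ltr0n//.
  by rewrite ler_peMr// ler1n.
apply: le_trans (gap_le1 _ _ _) _; apply: le_trans (ltW Ne).
by rewrite lef_pV2 ?posrE ?ltr0n// ler_nat ltnS ltnW.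
Qed.

End metrization.

(** Urysohn functions separating the rays ]-oo, a] and [b, +oo[, for [a < b]
    in [D], form a countable family that separates points. *)
Lemma countable_separating_metrizable (R : realType) (dK : Order.disp_t)
    (K : orderTopologicalType dK) (D : set K) :
  compact [set: K] -> countable D -> order_separating D -> metrizable R K.
Proof.
move=> Kcompact /countable_injP[r rinj] Dsep.
(* Injectivity is all that matters about the coding of pairs of indices. *)
have [code code_inj] : exists code : nat * nat -> nat, injective code.
  by exists pickle; exact: pcan_inj pickleK.
have Knormal := compact_normal order_hausdorff Kcompact.
have /choice[f fP] : forall n, exists g : K -> R,
    [/\ continuous g, forall x, 0 <= g x <= 1 & forall a b, D a -> D b ->
      (a < b)%O -> code (r a, r b) = n ->
      (forall x, (x <= a)%O -> g x = 0) /\ (forall x, (b <= x)%O -> g x = 1)].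
  move=> n.
  have [[[a b] [Da Db ab abn]]|nab] := pselect (exists ab : K * K,
      [/\ D ab.1, D ab.2, (ab.1 < ab.2)%O & code (r ab.1, r ab.2) = n]); last first.
    exists (fun=> 0); split=> [x|x|a b Da Db ab abn]; first exact: cvg_cst.
      by rewrite lexx ler01.
    by exfalso; apply: nab; exists (a, b).
  have ab0 : `]-oo, a]%classic `&` `[b, +oo[%classic = set0 :> set K.
    apply/seteqP; split=> // x []; rewrite /= !in_itv /= andbT => xa bx.
    by have := lt_le_trans ab (le_trans bx xa); rewrite ltxx.
  have [g [gcont g0 g1 g01]] := urysohn_ext_itv Knormal (@lray_closed _ K a)
    (@rray_closed _ K b) ab0 (@ltr01 R).
  exists g; split=> // [x|a' b' Da' Db' _].
    by have /= := g01 (g x) (ex_intro2 _ _ x I erefl); rewrite in_itv.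
  rewrite -abn => /code_inj[/rinj aE /rinj bE].
  rewrite (aE (mem_set Da') (mem_set Da)) (bE (mem_set Db') (mem_set Db)) /=.
  split=> x h.
    by apply: g0; exists x => //=; rewrite in_itv.
  by apply: g1; exists x => //=; rewrite in_itv /= andbT.
apply: (compact_metrizable (f := f)) => //.
- by move=> n; have [] := fP n.
- by move=> n x; have [_ /(_ x)] := fP n.
(* Two uses of Dsep produce a < b in D with x <= a and b <= y. *)
have fsep x y : (x < y)%O -> exists n, f n x <> f n y.
  move=> xy; have [_ [b Db /andP[xb yb]]] := Dsep x y xy.
  have [[a Da /andP[xa ab]] _] := Dsep x b xb.
  exists (code (r a, r b)); have [_ _ /(_ a b Da Db ab erefl)[f0 f1]] := fP (code (r a, r b)).
  by rewrite f0// f1//; apply/eqP; rewrite eq_sym oner_eq0.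
move=> x y fxy; apply/eqP; case: ltgtP => // /fsep[n]; first by rewrite fxy.
by rewrite fxy.
Qed.

Theorem proposition1p5 (R : realType) (dK : Order.disp_t)
    (K : orderTopologicalType dK)
    (hcompact : compact [set: K]%classic) (hfrag : fragmentable R K) :
  (forall (dW : Order.disp_t) (W : orderType dW),
      regular_uncountable_cardinal W -> ~ contains_copy W K ->
      weight_lt K [set: W]%classic) /\
  (forall (dW : Order.disp_t) (W : orderType dW),
      is_omega1 W -> ~ contains_copy W K -> metrizable R K).
Proof.
split=> dW W hW nocopy.
  have [D WD Dsep] := exists_separating_set hcompact hfrag hW nocopy.
  have [B [bB Bmin]] := exists_weight_basis K.
  exists B => //; apply/fewer_card_lt.
  apply: fewer_le (Bmin _ (separating_intervals_basis Dsep)) _.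
  exact: (fewer_separating_intervals hW).
have Wreg := omega1_regular hW.
have [D WD Dsep] := exists_separating_set hcompact hfrag Wreg nocopy.
apply: countable_separating_metrizable Dsep => //.
have /fewer_card_lt[/card_subP[C /card_eqPle[CD DC] _] _] := WD.
have [w Cw] := fewer_bounded Wreg (fewer_le CD WD).
have [_ _ /(_ w) cw] := hW.
exact: sub_countable (card_le_trans DC (subset_card_le Cw)) cw.
Qed.
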